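(* Let $k \geq 1$, let $i \in \{0,1,2,3\}$, and let $G$ be a connected $n$-vertex graph such that $(G,k)$ is not special. Then \[\iota(G,\mathcal{F}_{i,k}) \leq \left\lfloor \frac{n}{k+1} \right\rfloor.\] Moreover, equality holds if $i \in \{1,2,3\}$ and $G = B_{n,k}$.
   Context: All graphs are finite and simple. For $D \subseteq V(G)$, $N[D]$ is the union of the closed neighbourhoods of the vertices in $D$. Given a set $\mathcal{F}$ of graphs, an $\mathcal{F}$-graph is a graph isomorphic to a member of $\mathcal{F}$. A set $D \subseteq V(G)$ is $\mathcal{F}$-isolating if $G - N[D]$ contains no $\mathcal{F}$-graph as a subgraph, and $\iota(G,\mathcal{F})$ is the minimum size of an $\mathcal{F}$-isolating set of $G$. $\mathcal{F}_{0,k} = \{K_{1,k}\}$ (the star with $k$ leaves); $\mathcal{F}_{1,k}$ is the set of regular graphs of degree at least $k-1$; $\mathcal{F}_{2,k}$ is the set of graphs with chromatic number at least $k$; $\mathcal{F}_{3,k} = \mathcal{F}_{0,k} \cup \mathcal{F}_{1,k} \cup \mathcal{F}_{2,k}$. The pair $(G,k)$ is special if either $G$ is a $k$-clique, or $k=2$ and $G$ is a $5$-cycle. The graph $B_{n,k}$: let $q = \lfloor n/(k+1) \rfloor$ and $n = q(k+1)+r$ with $0 \le r \le k$. If $q=0$, $B_{n,k} = K_r$. If $q \geq 1$, take pairwise vertex-disjoint cliques $B_1,\dots,B_q$ on $k+1$ vertices and $B_{q+1}$ on $r$ vertices; let $q'=q$ if $r=0$ and $q'=q+1$ otherwise; choose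 $b_i \in V(B_i)$ for $i \in [q']$; $B_{n,k}$ has vertex set $\bigcup_{i=1}^{q'} V(B_i)$ and edge set $\{b_ib_{i+1} : i \in [q'-1]\} \cup \bigcup_{i=1}^{q'} E(B_i)$. *)

(* Defs.v *)
From mathcomp Require Import all_boot.
From mathcomp Require Import boolp.

Set Implicit Arguments.
Unset Strict Implicit.
Unset Printing Implicit Defensive.

Definition simple_graph (T : finType) (e : rel T) :=
  (forall x y, e x y = e y x) /\ (forall x, ~~ e x x).

Definition connected_graph (T : finType) (e : rel T) :=
  forall x y : T, connect e x y.

(* A "family" of graphs is a predicate on graphs H = (S, f) with vertex set
   S : {set T} and edge relation f : rel T (supported on S), for any finType T.
   All families below are defined isomorphism-invariantly. *)
Definition family := forall T : finType, {set T} -> rel T -> Prop.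

Definition star_fam (k : nat) : family := fun T S f =>
  exists c, c \in S /\ #|S| = k.+1 /\
    forall x y, f x y = ((x == c) && (y \in S) && (y != c))
                        || ((y == c) && (x \in S) && (x != c)).

Definition regular_fam (k : nat) : family := fun T S f =>
  S != set0 /\
  exists d, k - 1 <= d /\ forall x, x \in S -> #|[set y in S | f x y]| = d.

Definition chromatic_fam (k : nat) : family := fun T S f =>
  ~ exists c : T -> nat,
      (forall x, x \in S -> c x < k - 1) /\
      (forall x y, f x y -> c x != c y).

Definition union_fam (k : nat) : family := fun T S f =>
  star_fam k S f \/ regular_fam k S f \/ chromatic_fam k S f.

Definition Fam (i k : nat) : family :=
  match i with
  | 0 => star_fam k
  | 1 => regular_fam k
  | 2 => chromatic_fam k
  | _ => union_fam k
  end.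

Definition contains_F (F : family) (T : finType) (e : rel T) (X : {set T}) :=
  exists (S : {set T}) (f : rel T),
    S \subset X /\
    (forall x y, f x y -> [&& x \in S, y \in S & e x y]) /\
    (forall x y, f x y = f y x) /\
    F T S f.

Definition cnbhd (T : finType) (e : rel T) (D : {set T}) : {set T} :=
  [set x | [exists d in D, (d == x) || e d x]].

Definition isolating (F : family) (T : finType) (e : rel T) (D : {set T}) :=
  ~ contains_F F e (~: cnbhd e D).

(* iota(G,F): minimum size of an F-isolating set (V(G) itself is always
   F-isolating, so #|T| is a valid default for the minimum). *)
Definition iotaF (F : family) (T : finType) (e : rel T) : nat :=
  \big[minn/#|T|]_(D : {set T} | `[< isolating F e D >]) #|D|.

Definition special (T : finType) (e : rel T) (k : nat) :=
  (#|T| = k /\ forall x y : T, x != y -> e x y) \/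
  (k = 2 /\ exists g : 'I_5 -> T, bijective g /\
     forall i j : 'I_5, e (g i) (g j) =
       ((j : nat) == (i.+1 %% 5)) || ((i : nat) == (j.+1 %% 5))).

(* B_{n,k} on vertex set 'I_n: vertex v lies in block v %/ (k+1); blocks are
   cliques; the chosen vertex b_i of block i is its first vertex
   (v %% (k+1) == 0), and b_i b_{i+1} are adjacent. *)
Definition Bedge (n k : nat) : rel 'I_n := fun u v =>
  (u != v) &&
  ((u %/ k.+1 == v %/ k.+1) ||
   [&& u %% k.+1 == 0, v %% k.+1 == 0 &
       ((u %/ k.+1).+1 == v %/ k.+1) || ((v %/ k.+1).+1 == u %/ k.+1)]).
Arguments Bedge : clear implicits.

(* Main.v *)
(** A set D is F_{3,k}-isolating as soon as G - N[D] has maximum degree less than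
    k and no subgraph of minimum degree at least k - 1, since the latter rules out
    regular subgraphs and allows a greedy (k-1)-colouring.  Such a D is found by
    strong induction, for induced subgraphs X without special components.
    If X is connected with all degrees less than k, then either X is already fine or
    it is (k-1)-regular, and one vertex suffices.  If some X - x has a special
    component, put x in D: each special component of X - x loses a vertex to N[x],
    which makes it cheap enough, and induction handles the rest.  Otherwise take v of
    maximum degree, at least k.  If X - N[v] has no special component, put v in D.
    If it has a special component H, then for a neighbour x of v adjacent to
    y in H, one can dominate H + x by a set through y of size (|H| + 1)/(k + 1)
    and induct on X - H - x, unless that graph has a special component W.
    In that case W is all of X - H - x, for every such x, and there are at least
    two such x; comparing two of them leaves only explicit small graphs.

    For B_{n,k}, a set D missing one of the (k+1)-cliques leaves
    the k-clique of its non-connecting vertices undominated. *)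
Require Import Defs.
From mathcomp Require Import all_boot.
From mathcomp Require Import boolp.
From mathcomp Require Import zify.

Set Implicit Arguments.
Unset Strict Implicit.
Unset Printing Implicit Defensive.

Section Isolation.

Variables (T : finType) (e : rel T) (k : nat).
Hypothesis esym : forall x y, e x y = e y x.
Hypothesis eirr : forall x, e x x = false.
Hypothesis k_gt0 : 0 < k.

(** * Sparse sets, cuts and special components *)

Definition deg (S : {set T}) (x : T) := #|[set y in S | e x y]|.

(* If the maximum degree is less than [k], every regular or non-[k-1]-colourable
   subgraph contains an induced subgraph of minimum degree at least [k-1]; so
   sparseness amounts to containing no member of F_{3,k}. *)
Definition sparse (Y : {set T}) :=
  (forall x, x \in Y -> deg Y x < k) /\
  (forall S : {set T}, S \subset Y -> S != set0 ->
     exists2 x, x \in S & (deg S x).+1 < k).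

Definition separated (A B : {set T}) :=
  forall a b, a \in A -> b \in B -> e a b = false.

(** Connectivity is phrased by cuts instead of paths, so that arguments about components need no
    walks; the empty set counts as connected. *)
Definition conn (X : {set T}) :=
  forall A : {set T}, A \subset X -> A != set0 -> separated A (X :\: A) -> A = X.

Definition kclique (C : {set T}) :=
  #|C| = k /\ forall x y, x \in C -> y \in C -> x != y -> e x y.

Definition pentagon (a b c d f : T) :=
  [&& uniq [:: a; b; c; d; f],
      [&& e a b, e b c, e c d, e d f & e f a] &
      [&& ~~ e a c, ~~ e a d, ~~ e b d, ~~ e b f & ~~ e c f]].

Definition pent_set (C : {set T}) :=
  k = 2 /\ exists a b c d f, pentagon a b c d f /\ C = [set:: [:: a; b; c; d; f]].

Definition special_set C := kclique C \/ pent_set C.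

(** Cliques and 5-cycles being connected, such a [C] is a connected component of the subgraph
    induced by [Y]. *)
Definition special_piece (C Y : {set T}) :=
  [/\ special_set C, C \subset Y & separated C (Y :\: C)].

Definition no_special (Y : {set T}) := forall C, ~ special_piece C Y.

(** The floor bound in a form without division; [D] may use vertices outside [Y]. *)
Definition isolatable (Y : {set T}) :=
  exists2 D : {set T}, #|D| * k.+1 <= #|Y| & sparse (Y :\: cnbhd e D).

(** * Elementary facts on degrees, separation and neighbourhoods *)

Lemma deg_sub (A B : {set T}) x : A \subset B -> deg A x <= deg B x.
Proof.
move=> sAB; apply: subset_leq_card; apply/subsetP => y.
by rewrite !inE => /andP[/(subsetP sAB)-> ->].
Qed.

Lemma deg_separated (S A B : {set T}) x :
  S \subset A :|: B -> x \in A -> separated A B -> deg S x = deg (S :&: A) x.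
Proof.
move=> sS xA sep; apply: eq_card => y; rewrite !inE.
case yS: (y \in S) => //=; case exy: (e x y); rewrite ?andbF //= andbT.
move/(subsetP sS): yS; rewrite inE => /orP[->//|yB].
by rewrite (sep x y) in exy.
Qed.

Lemma separatedC A B : separated A B -> separated B A.
Proof. by move=> h a b aB bA; rewrite esym h. Qed.

Lemma separatedS (A B A' B' : {set T}) :
  A \subset A' -> B \subset B' -> separated A' B' -> separated A B.
Proof. by move=> /subsetP sA /subsetP sB h a b /sA aA /sB; apply: h. Qed.

Lemma sparseS (Y Z : {set T}) : Y \subset Z -> sparse Z -> sparse Y.
Proof.
move=> sYZ [h1 h2]; split=> [x xY|S sSY].
  by apply: leq_ltn_trans (deg_sub x sYZ) (h1 x (subsetP sYZ x xY)).
exact: h2 (subset_trans sSY sYZ).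
Qed.

Lemma sparse_sep A B : sparse A -> sparse B -> separated A B ->
  sparse (A :|: B).
Proof.
move=> [a1 a2] [b1 b2] sep; have sep' := separatedC sep; split=> [x|S sS S0].
  rewrite inE => /orP[xA|xB].
    by rewrite (deg_separated (subxx _) xA sep) setUK; apply: a1.
  rewrite setUC (deg_separated (subxx _) xB sep') setUK; exact: b1.
have [SA|SA] := eqVneq (S :&: A) set0; last first.
  have [x xS dx] := a2 _ (subsetIr S A) SA; exists x.
    by case/setIP: xS.
  by rewrite (deg_separated sS _ sep) //; case/setIP: xS.
have sSB : S \subset B.
  apply/subsetP => x xS; move/(subsetP sS): (xS); rewrite inE => /orP[xA|//].
  by have := in_set0 x; rewrite -SA inE xS xA.
exact: b2.
Qed.

Lemma deg_ltn (S : {set T}) x : x \in S -> deg S x < #|S|.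
Proof.
move=> xS; rewrite (cardsD1 x) xS add1n ltnS; apply: subset_leq_card.
apply/subsetP => y; rewrite !inE => /andP[-> exy]; rewrite andbT.
by apply: contraTneq exy => ->; rewrite eirr.
Qed.

(** A subset with all degrees at least [k - 1] has at least [k] vertices, so it is all of [Y], and
    [Y] is then complete. *)
Lemma sparse_small (Y : {set T}) : #|Y| <= k -> ~ kclique Y -> sparse Y.
Proof.
move=> cY ncl; split=> [x xY|S sSY S0].
  exact: leq_trans (deg_ltn xY) cY.
apply: contrapT => h; apply: ncl.
have hd x : x \in S -> k <= (deg S x).+1.
  by move=> xS; rewrite leqNgt; apply/negP => lt; apply: h; exists x.
have [x0 x0S] := set0Pn _ S0.
have kS : k <= #|S| := leq_trans (hd x0 x0S) (deg_ltn x0S).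
have eSY : S = Y by apply/eqP; rewrite eqEcard sSY (leq_trans cY kS).
subst S; have cYk : #|Y| = k by apply/eqP; rewrite eqn_leq cY kS.
split=> // x y xY yY nxy; have := hd x xY; apply: contraTT => nexy.
rewrite -ltnNge -cYk (cardsD1 x) xY (cardsD1 y) !inE eq_sym nxy yY !add1n !ltnS.
apply: subset_leq_card; apply/subsetP => z; rewrite !inE => /andP[-> exz].
by rewrite andbT; apply/andP; split; apply: contraTneq exz => ->; rewrite ?eirr.
Qed.

Lemma sparse_lt (Y : {set T}) : #|Y| < k -> sparse Y.
Proof. by move=> lt; apply: sparse_small (ltnW lt) _ => -[h _]; rewrite h ltnn in lt. Qed.

Lemma cnbhdP (D : {set T}) x :
  reflect (exists2 d, d \in D & (d == x) || e d x) (x \in cnbhd e D).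
Proof.
rewrite inE; apply: (iffP existsP) => [[d /andP[dD h]]|[d dD h]]; exists d => //.
by rewrite dD.
Qed.

Lemma mem_cnbhd (D : {set T}) x : x \in D -> x \in cnbhd e D.
Proof. by move=> xD; apply/cnbhdP; exists x; rewrite ?eqxx. Qed.

Lemma adj_cnbhd (D : {set T}) d x : d \in D -> e d x -> x \in cnbhd e D.
Proof. by move=> xD h; apply/cnbhdP; exists d; rewrite ?h ?orbT. Qed.

Lemma cnbhdU (D D' : {set T}) : cnbhd e (D :|: D') = cnbhd e D :|: cnbhd e D'.
Proof.
apply/setP => x; rewrite in_setU; apply/cnbhdP/orP => [[d]|].
  by rewrite inE => /orP[] dD h; [left|right]; apply/cnbhdP; exists d.
by case=> /cnbhdP[d dD h]; exists d => //; rewrite inE dD ?orbT.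
Qed.

(** * Structure and cost of cliques and 5-cycles *)

Lemma conn_kclique (C : {set T}) x : kclique C -> conn (C :\ x).
Proof.
move=> [_ cl] A sA A0 sep; apply/eqP; rewrite eqEsubset sA /=.
have [a aA] := set0Pn _ A0; apply/subsetP => b bC.
apply: contraT => bA; have aC := subsetP sA a aA.
have /sep : a \in A by []; move=> /(_ b); rewrite inE bA bC => /(_ isT).
move: aC bC; rewrite !inE => /andP[_ aC] /andP[_ bC]; rewrite cl //.
by apply: contraNneq bA => <-.
Qed.

Lemma pentagon_rot a b c d f : pentagon a b c d f -> pentagon b c d f a.
Proof.
case/and3P=> u /and5P[e1 e2 e3 e4 e5] /and5P[n1 n2 n3 n4 n5].
apply/and3P; split; last 2 first.
- by rewrite e1 e2 e3 e4 e5.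
- by rewrite n3 n4 n5 (esym c a) (esym d a) n1 n2.
by rewrite -(rot_uniq 1) in u.
Qed.

Lemma pentagon_rev a b c d f : pentagon a b c d f -> pentagon a f d c b.
Proof.
case/and3P=> u /and5P[e1 e2 e3 e4 e5] /and5P[n1 n2 n3 n4 n5].
apply/and3P; split; last 2 first.
- by rewrite (esym a f) (esym f d) (esym d c) (esym c b) (esym b a) e1 e2 e3 e4 e5.
- by rewrite (esym f c) (esym f b) (esym d b) n1 n2 n3 n4 n5.
by rewrite -(rot_uniq 1) -rev_uniq in u.
Qed.

Lemma pent_setE (C : {set T}) x : pent_set C -> x \in C ->
  exists b c d f, pentagon x b c d f /\ C = [set:: [:: x; b; c; d; f]].
Proof.
case=> _ [a [b [c [d [f [p ->]]]]]].
have p1 := pentagon_rot p; have p2 := pentagon_rot p1.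
have p3 := pentagon_rot p2; have p4 := pentagon_rot p3.
have r (s : seq T) n : [set:: s] = [set:: rot n s].
  by apply/setP => z; rewrite !inE mem_rot.
rewrite !inE => /or4P[/eqP->|/eqP->|/eqP->|/orP[/eqP->|/eqP->]].
- by exists b, c, d, f.
- by exists c, d, f, a; rewrite (r _ 1).
- by exists d, f, a, b; rewrite (r _ 2).
- by exists f, a, b, c; rewrite (r _ 3).
- by exists a, b, c, d; rewrite (r _ 4).
Qed.

Lemma pent_set_edge (C : {set T}) x y : pent_set C -> x \in C -> y \in C ->
  e x y -> exists c d f, pentagon x y c d f /\ C = [set:: [:: x; y; c; d; f]].
Proof.
move=> hC xC yC exy; have [b [c [d [f [p eC]]]]] := pent_setE hC xC.
case/and3P: (p)=> _ _ /and5P[/negbTE n1 /negbTE n2 _ _ _].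
move: yC exy; rewrite eC !inE => /or4P[/eqP->|/eqP->|/eqP->|/orP[/eqP->|/eqP->]].
- by rewrite eirr.
- by exists c, d, f.
- by rewrite n1.
- by rewrite n2.
- exists d, c, b; split; first exact: pentagon_rev.
  by apply/setP => z; rewrite !inE; do !case: (_ == _).
Qed.

Lemma conn_pent (C : {set T}) x : pent_set C -> x \in C -> conn (C :\ x).
Proof.
move=> hC xC; have [b [c [d [f [p eC]]]]] := pent_setE hC xC.
have e1 : C :\ x = [set:: [:: b; c; d; f]].
  case/and3P: p => /= /andP[nx _] _ _; rewrite eC; apply/setP => z; rewrite !inE.
  by case: eqP => [->|//]; move: nx; rewrite !inE => /negbTE->.
case/and3P: p => _ /and5P[_ bc cd df _] _.
rewrite {}e1 => A sA A0 sep.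
have step y z : z \in [set:: [:: b; c; d; f]] -> e y z -> y \in A -> z \in A.
  move=> zC eyz yA; apply: contraT => zA; move: eyz.
  by rewrite sep // inE zA zC.
have step2 y z : y \in [set:: [:: b; c; d; f]] -> z \in [set:: [:: b; c; d; f]] ->
    e y z -> (y \in A) = (z \in A).
  by move=> yC zC h; apply/idP/idP; apply: step; rewrite // esym.
have E1 : (b \in A) = (c \in A) by apply: step2; rewrite // !inE eqxx ?orbT.
have E2 : (c \in A) = (d \in A) by apply: step2; rewrite // !inE eqxx ?orbT.
have E3 : (d \in A) = (f \in A) by apply: step2; rewrite // !inE eqxx ?orbT.
have fA : f \in A.
  have [y yA] := set0Pn _ A0; move: (subsetP sA y yA) (yA).
  rewrite !inE => /or4P[]/eqP->; by rewrite ?E1 ?E2 ?E3.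
apply/eqP; rewrite eqEsubset sA; apply/subsetP => y.
by rewrite !inE => /or4P[]/eqP->; rewrite ?E1 ?E2 ?E3.
Qed.

(** Special graphs have no cut vertex. In the main induction this forces what is left of one special
    component into a single other component. *)
Lemma conn_special (C : {set T}) x : special_set C -> x \in C -> conn (C :\ x).
Proof. by move=> [/conn_kclique //|hC xC]; apply: conn_pent. Qed.

Lemma card_pentagon a b c d f : pentagon a b c d f ->
  #|[set:: [:: a; b; c; d; f]]| = 5.
Proof. by case/and3P => u _ _; rewrite cardsE; move/card_uniqP: u. Qed.

Lemma special_neq0 C : special_set C -> C != set0.
Proof.
case=> [[h _]|[_ [a [b [c [d [f [p ->]]]]]]]].
  by rewrite -card_gt0 h.
by rewrite -card_gt0 (card_pentagon p).
Qed.

(* A special set needs [t.+1] vertices but is one vertex short of paying for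
   them; losing a single vertex [y] to an outside neighbour saves one of the
   [t.+1], leaving a surplus of [k]. *)
Lemma special_cost (C : {set T}) y : special_set C -> y \in C ->
  exists t, [/\ #|C|.+1 = t.+1 * k.+1,
    (exists D : {set T}, [/\ y \in D, #|D| <= t.+1 & C \subset cnbhd e D]) &
    (exists2 D : {set T}, #|D| <= t & sparse (C :\ y :\: cnbhd e D))].
Proof.
move=> [[cC cl] yC|hC yC].
  (* For a clique, any vertex dominates everything, and losing [y] leaves only [k - 1] vertices. *)
  exists 0; split; first by rewrite cC mul1n.
    exists [set y]; rewrite set11 cards1; split=> //; apply/subsetP => z zC.
    have [->|nzy] := eqVneq z y; first by apply: mem_cnbhd; rewrite set11.
    by apply: (@adj_cnbhd _ y); rewrite ?set11 // cl // eq_sym.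
  exists set0; first by rewrite cards0.
  apply: (@sparseS _ (C :\ y)); first exact: subsetDl.
  by apply: sparse_lt; rewrite -cC [X in _ < X](cardsD1 y) yC.
have [b [c [d [f [p eC]]]]] := pent_setE hC yC; have k2 : k = 2 by case: hC.
(* For a 5-cycle, 5 + 1 = 2 * 3. Together, [y] and the vertex [c] at distance two dominate it; once
   [y] is gone, [c] alone leaves only [f]. *)
exists 1; split; first by rewrite eC (card_pentagon p) k2.
  exists [set y; c]; rewrite set21 cards2; split=> //; first by case: (_ != _).
  case/and3P: p => _ /and5P[e1 e2 e3 e4 e5] _.
  rewrite eC; apply/subsetP => z zC; rewrite !inE in zC.
  case/or4P: zC => [/eqP->|/eqP->|/eqP->|/orP[/eqP->|/eqP->]].
  - by apply/cnbhdP; exists y; rewrite ?inE eqxx.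
  - by apply/cnbhdP; exists y; rewrite ?inE ?eqxx ?e1 ?orbT.
  - by apply/cnbhdP; exists c; rewrite ?inE eqxx ?orbT.
  - by apply/cnbhdP; exists c; rewrite ?inE ?eqxx ?e3 ?orbT.
  - by apply/cnbhdP; exists y; rewrite ?inE ?eqxx // esym e5 orbT.
exists [set c]; first by rewrite cards1.
apply: sparse_lt; rewrite k2 ltnS -(cards1 f); apply: subset_leq_card.
case/and3P: p => _ /and5P[e1 e2 e3 e4 e5] _.
apply/subsetP => z; rewrite !inE eC !inE => /and3P[nz nzy].
rewrite (negPf nzy) /=; case/or4P=> // /eqP zE; case/negP: nz; apply/existsP; exists c;
  rewrite zE !inE ?eqxx //= ?e3 ?orbT //.
by rewrite esym e2 orbT.
Qed.

(** * Reduction steps for the induction *)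

Lemma special_piece_trans (C A X : {set T}) : A \subset X -> separated A (X :\: A) ->
  special_piece C A -> special_piece C X.
Proof.
move=> sAX sep [spC sCA sepC]; split=> //; first exact: subset_trans sAX.
move=> c z cC; rewrite inE => /andP[zC zX].
have [zA|zA] := boolP (z \in A); first by apply: sepC; rewrite // inE zC.
by apply: sep; [exact: (subsetP sCA)|rewrite inE zA].
Qed.

Lemma sparse_setU (A B D1 D2 : {set T}) :
  separated A B -> sparse (A :\: cnbhd e D1) -> sparse (B :\: cnbhd e D2) ->
  sparse ((A :|: B) :\: cnbhd e (D1 :|: D2)).
Proof.
move=> sep s1 s2.
apply: (@sparseS _ ((A :\: cnbhd e D1) :|: (B :\: cnbhd e D2))); last first.
  by apply: sparse_sep s1 s2 _; apply: separatedS sep; apply: subsetDl.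
rewrite cnbhdU; apply/subsetP => z.
rewrite !in_setD !in_setU !in_setD negb_or => /andP[/andP[-> ->]].
by rewrite /=.
Qed.

Lemma leq_cardU_mul (A B : {set T}) m : #|A :|: B| * m <= #|A| * m + #|B| * m.
Proof. by rewrite -mulnDl leq_mul2r -cardsUI leq_addr orbT. Qed.

Lemma isolatable_step (X Y D : {set T}) : Y \subset X -> X :\: Y \subset cnbhd e D ->
  #|D| * k.+1 <= #|X :\: Y| -> isolatable Y -> isolatable X.
Proof.
move=> sYX sD cD [D' cD' sp]; exists (D :|: D').
  apply: leq_trans (leq_cardU_mul _ _ _) _.
  by rewrite -(cardsID Y X) (setIidPr sYX) addnC leq_add.
apply: sparseS sp; rewrite cnbhdU; apply/subsetP => z.
rewrite !in_setD !in_setU negb_or => /andP[/andP[zD ->] zX] /=.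
by apply: contraR zD => zY; apply: (subsetP sD); rewrite in_setD zY.
Qed.

(** Special components are peeled off one at a time. Each contains a neighbour [y] of [x], so by
    [special_cost] it needs [t] vertices, where [t * k.+1] is its size minus [k]. The surplus [k]
    from one component, together with the vertex [x], later pays for choosing [x]. *)
Lemma strip_special_pieces x n :
  (forall Y : {set T}, #|Y| <= n -> no_special Y -> isolatable Y) ->
  forall Y : {set T}, #|Y| <= n ->
    (forall C, special_piece C Y -> exists2 y, y \in C & e x y) ->
  exists D : {set T}, [/\ #|D| * k.+1 <= #|Y|,
    (exists C, special_piece C Y) -> #|D| * k.+1 + k <= #|Y| &
    sparse (Y :\: cnbhd e (x |: D))].
Proof.
move=> IH Y; have [m] := ubnP #|Y|; elim: m Y => // m IHm Y /ltnSE cY cYn link.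
have [[C pC]|nC] := pselect (exists C, special_piece C Y); last first.
  have [|D cD sD] := IH Y cYn; first by move=> C pC; apply: nC; exists C.
  exists D; split=> //; apply: sparseS sD; apply: setDS.
  by rewrite cnbhdU subsetUr.
have [y yC exy] := link C pC; have [spC sCY sep] := pC.
have [t [cC _ [D0 cD0 sD0]]] := special_cost spC yC.
have eY : C :|: (Y :\: C) = Y by rewrite -{1}(setIidPr sCY) setID.
have cYC : #|Y| = #|C| + #|Y :\: C| by rewrite -(cardsID C Y) (setIidPr sCY).
have sep' : separated (Y :\: C) (Y :\: (Y :\: C)).
  by rewrite setDDr setDv set0U (setIidPr sCY); apply: separatedC.
have cC0 : 0 < #|C| by apply/card_gt0P; exists y.
have [D [cD _ sD]] : exists D : {set T}, [/\ #|D| * k.+1 <= #|Y :\: C|,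
    (exists C', special_piece C' (Y :\: C)) -> #|D| * k.+1 + k <= #|Y :\: C| &
    sparse (Y :\: C :\: cnbhd e (x |: D))].
  apply: IHm; [lia|lia|move=> C' pC'; apply: link].
  exact: special_piece_trans (subsetDl _ _) sep' pC'.
have le : #|D0 :|: D| * k.+1 + k <= #|Y|.
  have := leq_cardU_mul D0 D k.+1; have : #|D0| * k.+1 <= t * k.+1.
    by rewrite leq_mul2r cD0 orbT.
  rewrite mulSn in cC; lia.
exists (D0 :|: D); split=> //; first lia.
have -> : x |: (D0 :|: D) = (x |: D0) :|: (x |: D).
  by apply/setP => z; rewrite !inE; do !case: (z \in _) => //; do !case: (_ == _).
rewrite -eY; apply: sparse_setU => //.
apply: sparseS sD0; rewrite cnbhdU; apply/subsetP => z.
rewrite !in_setD !in_setU negb_or => /andP[/andP[z1 ->] zC] /=.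
rewrite in_set1 zC andbT; apply: contraNneq z1 => ->.
by apply: (@adj_cnbhd _ x); rewrite ?set11.
Qed.

(** Since [X] is connected, every special component of [X - x] is adjacent to [x], so
    [strip_special_pieces] applies, and the component [C] guarantees the surplus. *)
Lemma isolatable_cut (X : {set T}) x C : conn X -> x \in X ->
  (forall Y : {set T}, #|Y| < #|X| -> no_special Y -> isolatable Y) ->
  special_piece C (X :\ x) -> isolatable X.
Proof.
move=> cX xX IH pC; have cXx := cardsD1 x X; rewrite xX add1n in cXx.
have [] := @strip_special_pieces x #|X :\ x| _ (X :\ x) (leqnn _).
- by move=> Y cY; apply: IH; rewrite cXx ltnS.
- move=> C' [spC sC sep]; apply: contrapT => h.
  have eC : C' = X.
    apply: cX; [|exact: special_neq0|].
      exact: subset_trans sC (subsetDl _ _).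
    move=> c z cC; rewrite inE => /andP[zC zX].
    have [->|nzx] := eqVneq z x.
      rewrite esym; apply/negbTE/negP => exc; by apply: h; exists c.
    by apply: sep; rewrite // !inE zC nzx.
  by move: xX; rewrite -eC => /(subsetP sC); rewrite !inE eqxx.
move=> D [_ /(_ (ex_intro _ C pC)) cD sD]; exists (x |: D).
  by rewrite cardsU1 mulnDl cXx; case: (_ \notin _); lia.
apply: sparseS sD; apply/subsetP => z; rewrite !in_setD => /andP[z1 ->].
rewrite z1 andbT in_set1 /=; apply: contraNneq z1 => ->.
by apply: mem_cnbhd; rewrite setU11.
Qed.

Lemma isolatable_low_degree (X : {set T}) : conn X -> ~ special_set X ->
  (forall x, x \in X -> deg X x < k) -> isolatable X.
Proof.
move=> cX nX dX.
have [sX|nsX] := pselect (sparse X).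
  by exists set0; [rewrite cards0|apply: sparseS sX; apply: subsetDl].
(* Every vertex of such an [S] has at least [k - 1] neighbours inside [S], and less than [k] in [X],
   so no edge leaves [S]. *)
have full (S : {set T}) : S \subset X -> S != set0 ->
    ~ (exists2 x, x \in S & (deg S x).+1 < k) -> S = X.
  move=> sS S0 h; apply: cX => // a b aS; rewrite inE => /andP[bS bX].
  apply/negbTE/negP => eab; apply: h; exists a => //.
  apply: leq_ltn_trans (dX a (subsetP sS a aS)).
  apply: proper_card; apply/properP; split; last by exists b; rewrite !inE ?bX ?(negPf bS).
  by apply/subsetP => z; rewrite !inE => /andP[/(subsetP sS)-> ->].
have [S [sS S0 hS]] : exists S : {set T}, [/\ S \subset X, S != set0 &
    ~ (exists2 x, x \in S & (deg S x).+1 < k)].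
  apply: contrapT => h; apply: nsX; split=> // S sS S0.
  by apply: contrapT => h'; apply: h; exists S.
have eS := full _ sS S0 hS; subst S.
have [v vX] := set0Pn _ S0.
have kX : k <= #|X|.
  rewrite leqNgt; apply/negP => lt; apply: hS; exists v => //.
  exact: leq_ltn_trans (deg_ltn vX) lt.
(* With exactly [k] vertices, [X] would be a clique or sparse. The extra vertex makes one dominating
   vertex affordable. *)
have {}kX : k < #|X|.
  rewrite ltn_neqAle kX andbT; apply/eqP => cXk; apply: nsX.
  by apply: sparse_small; [rewrite cXk|move=> h; apply: nX; left].
(* Any vertex works: by [full], the only obstruction is [X] itself, and [v] has been removed from
   it. *)
exists [set v]; first by rewrite cards1 mul1n.
have vN : v \in cnbhd e [set v] by apply: mem_cnbhd; rewrite set11.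
split=> [x /setDP[xX _]|S' sS' S'0].
  by apply: leq_ltn_trans (deg_sub _ (subsetDl _ _)) (dX x xX).
apply: contrapT => h; have sX := subset_trans sS' (subsetDl _ _).
by have := subsetP sS' v; rewrite (full _ sX S'0 h) in_setD vN vX => /(_ isT).
Qed.

Lemma card_pent_set (C : {set T}) : pent_set C -> #|C| = 5.
Proof. by case=> _ [a [b [c [d [f [p ->]]]]]]; apply: card_pentagon p. Qed.

(* The case in which induction is blocked: the graph is a special set [H] plus a
   set [B] such that deleting from [B] any one of its vertices adjacent to [H]
   leaves a special set. *)
Section TwoSpecial.

Variables (B H : {set T}) (v : T).
Let X := B :|: H.
Hypothesis BH : forall z, z \in B -> z \notin H.
Hypothesis vB : v \in B.
Hypothesis vH : separated [set v] H.
Hypothesis spH : special_set H.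
Hypothesis linkB : forall x y, x \in B -> y \in H -> e x y ->
  e v x /\ special_set (B :\ x).

Let cX : #|X| = #|B| + #|H|.
Proof.
rewrite cardsU (_ : B :&: H = set0) ?cards0 ?subn0 //.
by apply/setP => z; rewrite !inE; case zB: (z \in B) => //=; apply/negbTE/BH.
Qed.

(** The clique [B - x2] contains [x1], so with the edge to [x2] the vertex [x1] dominates [B] and
    [y1]. Fewer than [k] vertices survive, and [B], with [k + 1] vertices, pays. *)
Lemma isolatable_two_cliques_adj x1 x2 y1 :
  x1 \in B -> x2 \in B -> x1 != x2 -> y1 \in H -> e x1 y1 ->
  kclique (B :\ x1) -> kclique (B :\ x2) -> kclique H -> e x1 x2 -> isolatable X.
Proof.
move=> x1B x2B x12 y1H e1 [cB _] [_ cl2] [cH _] e12.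
have cB1 := cardsD1 x1 B; rewrite x1B cB in cB1.
exists [set x1]; first by rewrite cards1 mul1n cX cB1 add1n leq_addr.
apply: (@sparseS _ (H :\ y1)); last first.
  by apply: sparse_lt; rewrite -cH [X in _ < X](cardsD1 y1) y1H.
apply/subsetP => z; rewrite in_setD in_setU in_setD1 => /andP[zN].
have zn1 : z != x1 by apply: contraNneq zN => ->; apply: mem_cnbhd; rewrite set11.
have nez : e x1 z = false.
  by apply: contraNF zN; apply: adj_cnbhd; rewrite set11.
case/orP=> [zB|->]; last by rewrite andbT; apply: contraFneq nez => ->.
have [zx2|nzx2] := eqVneq z x2; first by rewrite zx2 e12 in nez.
by rewrite cl2 // ?inE ?zB ?nzx2 ?x12 // eq_sym in nez.
Qed.

(** Choosing [x1] leaves at most the [k] vertices of [x2 |: (H :\ y1)]. As [X] is not isolatable,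
    these must all survive and form a clique. *)
Lemma two_cliques_link x1 x2 y1 :
  x1 \in B -> x2 \in B -> x1 != x2 -> y1 \in H -> e x1 y1 ->
  kclique (B :\ x1) -> kclique (B :\ x2) -> kclique H -> ~ isolatable X ->
  forall h, h \in H -> h != y1 -> e x2 h /\ e x1 h = false.
Proof.
move=> x1B x2B x12 y1H e1 [cB _] [_ cl2] [cH _] nX.
have cB1 := cardsD1 x1 B; rewrite x1B cB in cB1.
have sY : X :\: cnbhd e [set x1] \subset x2 |: (H :\ y1).
  apply/subsetP => z; rewrite in_setD !in_setU in_setD1 in_set1 => /andP[zN].
  have zn1 : z != x1 by apply: contraNneq zN => ->; apply: mem_cnbhd; rewrite set11.
  have nez : e x1 z = false.
    by apply: contraNF zN; apply: adj_cnbhd; rewrite set11.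
  case/orP=> [zB|->]; last by rewrite andbT orbC; apply/orP; left; apply: contraFneq nez => ->.
  have [//|nzx2] := eqVneq z x2.
  by rewrite cl2 // ?inE ?zB ?nzx2 ?x12 // eq_sym in nez.
have cR : #|x2 |: (H :\ y1)| = k.
  rewrite cardsU1 !inE (negPf (BH x2B)) andbF add1n -cH.
  by rewrite [X in _ = X](cardsD1 y1) y1H.
have [cl|ncl] := pselect (kclique (X :\: cnbhd e [set x1])); last first.
  case: nX; exists [set x1]; first by rewrite cards1 mul1n cX cB1 add1n leq_addr.
  by apply: sparse_small ncl; rewrite -cR subset_leq_card.
case: cl => cY clY.
have eY : X :\: cnbhd e [set x1] = x2 |: (H :\ y1).
  by apply/eqP; rewrite eqEcard sY cY cR leqnn.
move=> h hH nhy; have hY : h \in X :\: cnbhd e [set x1] by rewrite eY !inE nhy hH orbT.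
split.
  apply: clY => //; first by rewrite eY setU11.
  by apply: contraNneq (BH x2B) => ->.
case/setDP: hY => _ /negP hN; apply/negbTE/negP => h1; apply: hN.
by apply: adj_cnbhd h1; rewrite set11.
Qed.

Lemma isolatable_two_cliques x1 x2 y1 y2 :
  x1 \in B -> x2 \in B -> x1 != x2 -> ~ special_set X ->
  y1 \in H -> e x1 y1 -> y2 \in H -> e x2 y2 ->
  kclique (B :\ x1) -> kclique (B :\ x2) -> kclique H -> isolatable X.
Proof.
move=> x1B x2B x12 nsp y1H e1 y2H e2 cl1 cl2 clH; apply: contrapT => nX; apply: nsp.
have n12 : e x1 x2 = false.
  apply/negbTE/negP => e12; apply: nX.
  exact: isolatable_two_cliques_adj x12 y1H e1 cl1 cl2 clH e12.
have [ev1 _] := linkB x1B y1H e1; have [ev2 _] := linkB x2B y2H e2.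
have L1 := two_cliques_link x1B x2B x12 y1H e1 cl1 cl2 clH nX.
have x21 : x2 != x1 by rewrite eq_sym.
have L2 := two_cliques_link x2B x1B x21 y2H e2 cl2 cl1 clH nX.
have vx1 : v != x1 by apply: contraTneq ev1 => ->; rewrite eirr.
have vx2 : v != x2 by apply: contraTneq ev2 => ->; rewrite eirr.
have k2 : 1 < k.
  case: cl1 => <- _; rewrite (cardsD1 v) !inE vx1 vB (cardsD1 x2) !inE x2B.
  by rewrite eq_sym vx2 eq_sym x12.
case: (clH) => cH clHe.
(* By [L1], a vertex of [H] other than [y1] is not adjacent to [x1]; by [L2], one other than [y2]
   is. So [H] shrinks to an edge, [k = 2], and [X] becomes the 5-cycle [v x1 y1 y2 x2]. *)
have H2 h : h \in H -> h != y1 -> h = y2.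
  move=> hH nh; have [_ e1h] := L1 h hH nh.
  by apply/eqP; apply: contraFT e1h => nh2; case: (L2 h hH nh2).
have [h hH nh] : exists2 h, h \in H & h != y1.
  have : 0 < #|H :\ y1| by move: k2; rewrite -cH (cardsD1 y1) y1H.
  by case/card_gt0P => h; rewrite !inE => /andP[nh hH]; exists h.
have y12 : y2 != y1 by rewrite -(H2 h hH nh).
have y21 : y1 != y2 by rewrite eq_sym.
have eH : H = [set y1; y2].
  apply/setP => z; rewrite !inE; have [->|nz] := eqVneq z y1; first by rewrite y1H.
  by apply/idP/eqP => [zH|->//]; apply: H2.
have k2E : k = 2 by rewrite -cH eH cards2 y21.
have eB : B = [set x1; x2; v].
  apply/eqP; rewrite eq_sym eqEcard; apply/andP; split.
    by apply/subsetP => z; rewrite !inE => /orP[/orP[]|]/eqP->.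
  have cB1 := cardsD1 x1 B; rewrite x1B (proj1 cl1) k2E in cB1.
  by rewrite cB1 -setUA cardsU1 cards2 !inE negb_or x12 eq_sym vx1 eq_sym vx2.
right; split=> //; exists v, x1, y1, y2, x2; split; last first.
  apply/setP => z; rewrite !inE eB eH !inE.
  by do !case: (_ == _).
have nBH x y : x \in B -> y \in H -> (x == y) = false.
  by move=> xB yH; apply: contraNF (BH xB) => /eqP->.
have nvH y : y \in H -> e v y = false by move=> yH; apply: vH; rewrite ?set11.
have [e2y1 ne1y2] : e x2 y2 /\ e x1 y2 = false by apply: L1.
have [_ ne2y1] := L2 y1 y1H y21.
apply/and3P; split.
- by rewrite /= !inE (eq_sym y1 x2) (eq_sym y2 x2) (nBH v y1) // (nBH v y2) //
    (nBH x1 y1) // (nBH x1 y2) // (nBH x2 y1) // (nBH x2 y2) //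
    (negPf vx1) (negPf vx2) (negPf x12) (negPf y21).
- by rewrite ev1 e1 clHe // esym e2 esym ev2.
- by rewrite !nvH // ne1y2 n12 esym ne2y1.
Qed.

(** The 5-cycles [B - x1] and [B - x2] share a path [v c b a], whose ends are both joined to [x1]
    and to [x2]. Hence [x1] and [a] dominate all of [B] except [c], and also [y1], after which [H]
    costs only [t] vertices. *)
Lemma isolatable_pentagon x1 x2 y1 :
  x1 \in B -> x2 \in B -> x1 != x2 -> e v x2 -> y1 \in H -> e x1 y1 ->
  pent_set (B :\ x1) -> pent_set (B :\ x2) -> isolatable X.
Proof.
move=> x1B x2B x12 ev2 y1H e1 pt1 pt2.
have k2 : k = 2 by case: pt1.
have [ev1 _] := linkB x1B y1H e1.
have vx1 : v != x1 by apply: contraTneq ev1 => ->; rewrite eirr.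
have vx2 : v != x2 by apply: contraTneq ev2 => ->; rewrite eirr.
have [vB1 vB2] : v \in B :\ x1 /\ v \in B :\ x2 by rewrite !inE vB vx1 vx2.
have [x2B1 x1B2] : x2 \in B :\ x1 /\ x1 \in B :\ x2.
  by rewrite !inE x1B x2B x12 eq_sym x12.
have [e2v e1v] : e x2 v /\ e x1 v by rewrite !(esym _ v).
have [c [b [a [p eB]]]] := pent_set_edge pt1 x2B1 vB1 e2v.
have [c' [b' [a' [p' eB']]]] := pent_set_edge pt2 x1B2 vB2 e1v.
have mB z : z \in [:: c; b; a] -> z \in [:: v; c'; b'; a'].
  move=> hz; have : z \in B :\ x1.
    by rewrite eB !inE; move: hz; rewrite !inE => /or3P[]->; rewrite ?orbT.
  rewrite !inE => /andP[nz1 zB].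
  have nz2 : z != x2.
    case/and3P: p => /= /andP[nx _] _ _; apply: contraNneq nx => <-.
    by rewrite inE hz orbT.
  have : z \in B :\ x2 by rewrite !inE nz2 zB.
  by rewrite eB' !inE (negPf nz1).
case/and3P: (p) => _ /and5P[_ vc cb ba ax2] /and5P[/negP n1 /negP n2 /negP n3 /negP n4 /negP n5].
case/and3P: (p') => _ /and5P[_ vc' cb' ba' ax1] /and5P[_ _ /negP n3' /negP n4' /negP n5'].
have irr z : ~ e z z by rewrite eirr.
(* The edges and non-edges of the two cycles leave each shared vertex only one possible position. *)
have ec : c = c'.
  have := mB c; rewrite !inE eqxx => /(_ isT) /or4P[]/eqP E //.
  - by case: (irr v); rewrite -{2}E.
  - by case: n3'; rewrite -E.
  - by case: n4'; rewrite -E.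
have eb : b = b'.
  have := mB b; rewrite !inE eqxx orbT => /(_ isT) /or4P[]/eqP E //.
  - by case: n2; rewrite E.
  - by case: (irr b); rewrite {1}E -ec.
  - by case: n5'; rewrite -E -ec.
have ea : a = a'.
  have := mB a; rewrite !inE eqxx !orbT => /(_ isT) /or4P[]/eqP E //.
  - by case: n3; rewrite esym -E.
  - by case: n4; rewrite E -ec.
  - by case: (irr a); rewrite {1}E -eb.
subst c' b' a'.
have cB : c \in B.
  by have : c \in B :\ x1; [rewrite eB !inE eqxx !orbT|rewrite !inE => /andP[]].
have aB : a \in B.
  by have : a \in B :\ x1; [rewrite eB !inE eqxx !orbT|rewrite !inE => /andP[]].
have bB : b \in B.
  by have : b \in B :\ x1; [rewrite eB !inE eqxx !orbT|rewrite !inE => /andP[]].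
have cardB : #|B| = 6 by rewrite (cardsD1 x1) x1B (card_pent_set pt1).
have neq y z w : e y w -> ~ e z w -> y != z by move=> h h'; apply/eqP => E; rewrite E in h.
(* Otherwise [B - c] is special by [linkB]: it is too large for a 2-clique, and in a 5-cycle [a]
   could not have the three neighbours [x1], [x2] and [b]. *)
have cH : separated [set c] H.
  move=> ? y /set1P-> yH; apply/negbTE/negP => ecy.
  have [_ [[cB' _]|ptc]] := linkB cB yH ecy.
    by move: (cardsD1 c B); rewrite cB cB' cardB k2.
  have nca : a != c by apply: (neq _ _ _ ax2) => h; apply: n1; rewrite esym.
  have aBc : a \in B :\ c by rewrite !inE nca.
  have ncx1 : x1 != c.
    by apply: (@neq x1 c a) => //; rewrite esym.
  have x1Bc : x1 \in B :\ c by rewrite !inE ncx1.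
  have [p3 [q3 [r3 [P3 eBc]]]] := pent_set_edge ptc aBc x1Bc ax1.
  case/and3P: P3 => _ _ /and5P[/negP m1 /negP m2 _ _ _].
  have r3E z : z \in B -> z != c -> z != x1 -> e a z -> z = r3.
    move=> zB nzc nz1 eaz; have : z \in B :\ c by rewrite !inE nzc.
    rewrite eBc !inE (negPf nz1) => /or4P[/eqP E|//|/eqP E|/orP[]/eqP E] //.
    - by case: (irr a); rewrite -{2}E.
    - by case: m1; rewrite -E.
    - by case: m2; rewrite -E.
  have E2 : x2 = r3.
    apply: r3E => //; last by rewrite eq_sym.
    by rewrite eq_sym; apply: (neq _ _ _ cb).
  have Eb : b = r3.
    apply: r3E => //; last by rewrite esym.
      exact: (neq _ _ _ ba).
    by have : b \in B :\ x1; [rewrite eB !inE eqxx !orbT|rewrite !inE => /andP[]].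
  by case: n1; rewrite E2 -Eb esym.
have [t [cHt _ [D0 cD0 sD0]]] := special_cost spH y1H.
exists ([set x1; a] :|: D0).
  have cardH : #|H| = t * 3 + 2 by move: cHt; rewrite k2 mulSn addnC addn3 addn2 => -[].
  apply: leq_trans (leq_cardU_mul _ _ _) _.
  rewrite cX cardB cards2 cardH k2 (addnC (t * 3)) addnA; apply: leq_add.
    by case: (_ != _).
  by rewrite leq_mul2r cD0.
apply: (@sparseS _ ([set c] :|: (H :\ y1 :\: cnbhd e D0))); last first.
  apply: sparse_sep => //; first by apply: sparse_lt; rewrite cards1 k2.
  by apply: separatedS cH => //; apply: subset_trans (subsetDl _ _) (subsetDl _ _).
have [N1 Na] : x1 \in [set x1; a] /\ a \in [set x1; a] by rewrite !inE !eqxx orbT.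
apply/subsetP => z; rewrite cnbhdU !(in_setD, in_setU, in_set1) negb_or.
case/andP=> /andP[/negP zN ->] /orP[zB|zH] /=; last first.
  rewrite zH andbT; apply/orP; right; apply/eqP => zy; case: zN.
  by rewrite zy; apply: adj_cnbhd N1 e1.
have [z1|nz1] := eqVneq z x1; first by case: zN; rewrite z1; apply: mem_cnbhd.
have : z \in B :\ x1 by rewrite !inE nz1.
rewrite eB => zE; rewrite !inE in zE.
case/or4P: zE => [/eqP zE|/eqP zE|/eqP ->|/orP[]/eqP zE].
- by case: zN; rewrite zE; apply: adj_cnbhd Na ax2.
- by case: zN; rewrite zE; apply: adj_cnbhd N1 e1v.
- by rewrite eqxx.
- by case: zN; rewrite zE; apply: adj_cnbhd Na _; rewrite esym.
- by case: zN; rewrite zE; apply: mem_cnbhd.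
Qed.

Lemma isolatable_two_special x1 x2 y1 y2 :
  x1 \in B -> x2 \in B -> x1 != x2 -> ~ special_set X ->
  y1 \in H -> e x1 y1 -> y2 \in H -> e x2 y2 ->
  (forall z, z \in X -> deg X z <= deg X v) -> isolatable X.
Proof.
move=> x1B x2B x12 nsp y1H e1 y2H e2 maxv.
have [ev1 sp1] := linkB x1B y1H e1; have [ev2 sp2] := linkB x2B y2H e2.
have c1 := cardsD1 x1 B; have c2 := cardsD1 x2 B; rewrite x1B in c1; rewrite x2B in c2.
have vx1 : v != x1 by apply: contraTneq ev1 => ->; rewrite eirr.
have vx2 : v != x2 by apply: contraTneq ev2 => ->; rewrite eirr.
case: sp1 => [cl1|pt1]; case: sp2 => [cl2|pt2].
- case: (spH) => [clH|ptH]; first exact: isolatable_two_cliques e1 _ e2 cl1 cl2 clH.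
  have [b [c [d [f [p eH]]]]] := pent_setE ptH y1H.
  have k2 : k = 2 by case: ptH.
  (* Here [B] has three vertices, so [v] has degree at most 2, while [y1] has its two neighbours on
     the 5-cycle and also [x1]. This contradicts the maximality of [v]. *)
  have := maxv y1; rewrite inE y1H orbT => /(_ isT); rewrite leqNgt => /negP[].
  have d2 : deg X v <= 2.
    apply: (@leq_trans #|B :\ v|); last first.
      by move: (cardsD1 v B); rewrite vB c1 (proj1 cl1) k2 !add1n => -[->].
    apply: subset_leq_card; apply/subsetP => z; rewrite !inE => /andP[zX evz].
    have nzv : z != v by apply: contraTneq evz => ->; rewrite eirr.
    rewrite nzv; case/orP: zX => // zH.
    by rewrite (vH (set11 v) zH) in evz.
  apply: leq_ltn_trans d2 _.
  case/and3P: p => u /and5P[yb _ _ _ fy] _.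
  have u3 : uniq [:: x1; b; f].
    move: u; rewrite /= !inE !negb_or => /and5P[_ /and3P[_ _ ->] _ _ _].
    have nH z : z \in H -> x1 != z by move=> zH; apply: contraNneq (BH x1B) => ->.
    by rewrite !nH // eH !inE eqxx !orbT.
  move/card_uniqP: (u3) => /= <-; apply: subset_leq_card; apply/subsetP => z.
  rewrite !inE => /or3P[]/eqP->.
  - by rewrite x1B esym e1.
  - by rewrite eH !inE eqxx !orbT.
  - by rewrite eH !inE eqxx !orbT esym.
(* [B - x1] and [B - x2] have equal size, so they cannot be a 2-clique and a 5-cycle. *)
- by move: c1; rewrite c2 (proj1 cl1) (card_pent_set pt2); case: pt2 => ->.
- by move: c1; rewrite c2 (proj1 cl2) (card_pent_set pt1); case: pt1 => ->.
exact: isolatable_pentagon ev2 y1H e1 pt1 pt2.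
Qed.

End TwoSpecial.

(** * The main induction *)

Lemma isolatable_no_special (X : {set T}) : no_special X -> isolatable X.
Proof.
have [n] := ubnP #|X|; elim: n X => // n IHn X /ltnSE cXn nsp.
have IH (Y : {set T}) : #|Y| < #|X| -> no_special Y -> isolatable Y.
  by move=> cY; apply: IHn; apply: leq_trans cXn.
have [cX|ncX] := pselect (conn X); last first.
  have [A [sA A0 sep neA]] : exists A : {set T},
      [/\ A \subset X, A != set0, separated A (X :\: A) & A <> X].
    apply: contrapT => h; apply: ncX => A sA A0 sep.
    by apply: contrapT => neA; apply: h; exists A.
  have eX : A :|: (X :\: A) = X by rewrite -{1}(setIidPr sA) setID.
  have sep' : separated (X :\: A) (X :\: (X :\: A)).
    by rewrite setDDr setDv set0U (setIidPr sA); apply: separatedC.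
  have cXA : #|X| = #|A| + #|X :\: A| by rewrite -(cardsID A X) (setIidPr sA).
  have ltA : #|A| < #|X|.
    by apply: proper_card; rewrite properEneq sA andbT; apply/eqP.
  have [|D1 cD1 sD1] := IH A ltA.
    by move=> C pC; apply: (nsp C); apply: special_piece_trans pC.
  have [||D2 cD2 sD2] := IH (X :\: A).
  - by move: A0; rewrite -card_gt0; lia.
  - move=> C pC; apply: (nsp C); apply: special_piece_trans pC => //; exact: subsetDl.
  exists (D1 :|: D2); first by apply: leq_trans (leq_cardU_mul _ _ _) _; lia.
  by rewrite -eX; apply: sparse_setU.
have nX : ~ special_set X.
  by move=> spX; apply: (nsp X); split=> // a b _; rewrite setDv inE.
apply: contrapT => nI.
have ncut x C : x \in X -> ~ special_piece C (X :\ x).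
  by move=> xX pC; apply: nI; apply: isolatable_cut pC.
have [v0 v0X dv0] : exists2 v, v \in X & k <= deg X v.
  apply: contrapT => h; apply: nI; apply: isolatable_low_degree => // x xX.
  by rewrite ltnNge; apply/negP => kx; apply: h; exists x.
have [v vX maxv] : exists2 v, v \in X & forall z, z \in X -> deg X z <= deg X v.
  by have [v vX maxv] := arg_maxnP (deg X) v0X; exists v.
have dv : k <= deg X v := leq_trans dv0 (maxv v0 v0X).
have [H [spH sHR sepH]] : exists H, special_piece H (X :\: cnbhd e [set v]).
  apply: contrapT => h; apply: nI.
  have vN : v \in cnbhd e [set v] by apply: mem_cnbhd; rewrite set11.
  apply: (@isolatable_step _ (X :\: cnbhd e [set v]) [set v]).
  - exact: subsetDl.
  - by rewrite setDDr setDv set0U subsetIr.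
  (* The closed neighbourhood of [v] in [X] has at least [k + 1] vertices, which pays for [v]. *)
  - rewrite cards1 mul1n setDDr setDv set0U (cardsD1 v) in_setI vX vN add1n ltnS.
    apply: leq_trans dv _; apply: subset_leq_card; apply/subsetP => z.
    rewrite inE => /andP[zX evz]; rewrite in_setD1 in_setI zX.
    rewrite (adj_cnbhd (set11 v) evz) !andbT.
    by apply: contraTneq evz => ->; rewrite eirr.
  apply: IH => [|C pC]; last by apply: h; exists C.
  apply: proper_card; apply/properP; split; first exact: subsetDl.
  by exists v; rewrite // in_setD vN.
have sHX : H \subset X := subset_trans sHR (subsetDl _ _).
have HN z : z \in H -> z \notin cnbhd e [set v] by move/(subsetP sHR)/setDP => [].
have vnH : v \notin H.
  by apply/negP => /HN /negP[]; apply: mem_cnbhd; rewrite set11.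
have vH : separated [set v] H.
  move=> ? z /set1P-> zH; apply: contraNF (HN z zH); apply: adj_cnbhd; exact: set11.
have nbr z w : z \in H -> w \in X -> w \notin H -> e z w -> e v w.
  move=> zH wX wH ezw.
  have : w \in cnbhd e [set v].
    apply: contraT => wN; move: ezw; rewrite sepH //.
    by rewrite in_setD wH in_setD wN.
  case/cnbhdP => _ /set1P-> /orP[/eqP E|//].
  by move: ezw; rewrite -E esym vH ?set11.
pose linked x := [/\ x \in X, x \notin H & exists2 y, y \in H & e x y].
have vlinked x : linked x -> v \in X :\: H :\ x /\ e v x.
  case=> xX xH [y yH exy]; have evx : e v x by apply: (nbr y) => //; rewrite esym.
  rewrite !inE vX vnH; split=> //; rewrite !andbT.
  by apply: contraTneq evx => ->; rewrite eirr.
(* If [X - H - x] had no special component, the set [D] through [y] would pay for [H + x] exactly.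
   The component [W] has a neighbour in [H], or it would be a special component of [X - x]; that
   linked vertex is adjacent to [v], so [v] lies in [W]. *)
have linkW x : linked x -> exists W, [/\ special_piece W (X :\: H :\ x), v \in W &
    exists2 x', x' \in W & linked x'].
  move=> lx; have [vZ _] := vlinked x lx; case: (lx) => xX xH [y yH exy].
  have [t [cHt [D [yD cD sD]] _]] := special_cost spH yH.
  have eXZ : X :\: (X :\: H :\ x) = x |: H.
    apply/setP => z; rewrite !inE; have [->|] := eqVneq z x; first by rewrite xX.
    by case zH: (z \in H) => /=; [rewrite (subsetP sHX)|rewrite andNb].
  have [W pW] : exists W, special_piece W (X :\: H :\ x).
    apply: contrapT => h; apply: nI.
    apply: (@isolatable_step _ (X :\: H :\ x) D).
    - exact: subset_trans (subsetDl _ _) (subsetDl _ _).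
    - rewrite eXZ subUset sD andbT sub1set; apply: (adj_cnbhd yD).
      by rewrite esym.
    - by rewrite eXZ cardsU1 xH add1n cHt leq_mul2r cD orbT.
    apply: IH => [|C pC]; last by apply: h; exists C.
    apply: proper_card; apply/properP; split; last by exists x; rewrite // !inE eqxx.
    exact: subset_trans (subsetDl _ _) (subsetDl _ _).
  exists W; have [spW sW sepW] := pW.
  have [x' x'W lx'] : exists2 x', x' \in W & linked x'.
    apply: contrapT => h; apply: (ncut x W xX); split=> //.
      by apply: subset_trans sW _; apply: setSD; apply: subsetDl.
    move=> w z wW; rewrite !inE => /and3P[zW nzx zX].
    have := subsetP sW w wW; rewrite !inE => /and3P[_ wH wX].
    have [zH|zH] := boolP (z \in H); last by apply: sepW; rewrite // !inE zW nzx zH.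
    by apply/negbTE/negP => ewz; apply: h; exists w => //; split=> //; exists z.
  split=> //; last by exists x'.
  apply: contraT => vW; have [_ evx'] := vlinked x' lx'.
  by move: evx'; rewrite esym sepW // inE vW.
(* The component [W'] obtained from [x'] contains [x], a neighbour of [v]. As [W' - x] is connected
   and contains [v], it lies inside [W]. *)
have linkE x : linked x -> special_set (X :\: H :\ x) /\
    exists2 x', linked x' & x' != x.
  move=> lx; have [W [[spW sW sepW] vW [x' x'W lx']]] := linkW x lx.
  have nx'x : x' != x by have := subsetP sW x' x'W; rewrite !inE => /andP[].
  split; last by exists x'.
  suff <- : W = X :\: H :\ x by [].
  have [W' [[spW' sW' sepW'] vW' _]] := linkW x' lx'.
  have [_ evx] := vlinked x lx; case: (lx) => xX xH _.
  have xW' : x \in W'.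
    by apply: contraT => xW'; rewrite sepW' // !inE xW' xX xH eq_sym nx'x in evx.
  have sub : W' :\ x \subset W.
    apply/setIidPl; apply: (conn_special spW' xW'); first exact: subsetIl.
      apply/set0Pn; exists v; rewrite !inE vW' vW !andbT.
      by apply: contraTneq evx => ->; rewrite eirr.
    move=> a b /setIP[_ aW]; rewrite !inE => /andP[nb /andP[nbx bW']].
    apply: sepW; rewrite // !inE nbx.
    have := subsetP sW' b bW'; rewrite !inE => /and3P[_ -> ->].
    by move: nb; rewrite nbx bW' /= => ->.
  (* The vertices of [X - H - x] outside [W] have no neighbour in [W], none in [H] (it would make
     them neighbours of [v]), and [x] is not one either, by [W']. Connectivity of [X] leaves no such
     vertex. *)
  apply/eqP; rewrite eqEsubset sW /= -setD_eq0; apply: contraT => P0.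
  have PX : X :\: H :\ x :\: W = X.
    apply: cX P0 _; first by do 2! apply: subset_trans (subsetDl _ _) _; apply: subsetDl.
    move=> p z pP; have := pP; rewrite !inE => /and4P[pW npx pH pX] /andP[zP zX].
    have [->|nzx] := eqVneq z x.
      rewrite esym; apply: sepW' => //; rewrite !inE pH pX !andbT.
      apply/andP; split; last by apply: contraNneq pW => ->.
      by apply: contra pW => pW'; apply: (subsetP sub); rewrite !inE npx.
    have [zH|zH] := boolP (z \in H).
      apply/negbTE/negP => epz; have evp : e v p by apply: (nbr z) => //; rewrite esym.
      by rewrite sepW // !inE pW npx pH in evp.
    move: zP; rewrite nzx zH zX !andbT negbK => zW.
    by rewrite esym; apply: sepW; rewrite // !inE pW npx pH.
  by have := vX; rewrite -PX inE vW.
have [x1 l1] : exists x, linked x.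
  apply: contrapT => h; have eH : H = X.
    apply: cX => //; first exact: special_neq0.
    move=> z w zH; rewrite inE => /andP[wH wX]; apply/negbTE/negP => ezw.
    by apply: h; exists w; split=> //; exists z; rewrite // esym.
  by rewrite eH vX in vnH.
have [_ [x2 l2 n21]] := linkE x1 l1.
have [x1X x1H [y1 y1H e1]] := l1; have [x2X x2H [y2 y2H e2]] := l2.
have eX : (X :\: H) :|: H = X.
  by rewrite setUC -{1}(setIidPr sHX) setID.
apply: nI; rewrite -eX.
apply: (@isolatable_two_special _ _ v _ _ _ spH _ x1 x2 y1 y2); rewrite ?inE ?eX //.
- by move=> z /setDP[].
- by rewrite vnH.
- move=> x y /setDP[xX xH] yH exy; have lx : linked x by split=> //; exists y.
  by have [_ ?] := vlinked x lx; have [? _] := linkE x lx.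
- by rewrite x1H.
- by rewrite x2H.
- by rewrite eq_sym.
Qed.

(** * From sparse sets to isolating sets *)

Lemma sparse_coloring (Y : {set T}) : sparse Y -> exists c : T -> nat,
  (forall x, x \in Y -> c x < k - 1) /\
  (forall x y, x \in Y -> y \in Y -> e x y -> c x != c y).
Proof.
move=> [_ sp]; have [n] := ubnP #|Y|; elim: n Y sp => // n IH Y sp /ltnSE cY.
have [->|Y0] := eqVneq Y set0.
  by exists (fun=> 0); split=> [x|x y]; rewrite inE.
have [x xY dx] := sp Y (subxx _) Y0.
have [||c [c1 c2]] := IH (Y :\ x).
- by move=> S sS; apply: sp; apply: subset_trans sS (subsetDl _ _).
- by rewrite (cardsD1 x) xY in cY.
pose s := [seq c y | y <- enum [set y in Y | e x y]].
(* The chosen vertex [x] has fewer than [k - 1] neighbours in [Y], so their colours do not exhaust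
   the palette. *)
have [m mk ms] : exists2 m, m < k - 1 & m \notin s.
  apply: contrapT => h; have : k - 1 <= deg Y x.
    rewrite -(size_iota 0 (k - 1)) /deg cardE -(size_map c).
    apply: uniq_leq_size (iota_uniq _ _) _ => m; rewrite mem_iota add0n => mk.
    by apply: contraT => ms; case: h; exists m.
  by lia.
exists (fun y => if y == x then m else c y); split=> [y yY|].
  by case: eqP => // /eqP nyx; apply: c1; rewrite !inE nyx.
have ms' z : z \in Y -> e x z -> c z != m.
  move=> zY exz; apply: contraNneq ms => <-; apply: map_f.
  by rewrite mem_enum inE zY.
move=> y z yY zY eyz; have [yx|nyx] := eqVneq y x; have [zx|nzx] := eqVneq z x.
- by rewrite yx zx eirr in eyz.
- by rewrite eq_sym ms' // -yx.
- by rewrite ms' // -zx esym.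
- by apply: c2; rewrite ?inE ?nyx ?nzx.
Qed.

(** A star has a centre of degree [k], against the degree bound; a regular member has all degrees at
    least [k - 1], against the second half of [sparse]; the colouring excludes the rest. *)
Lemma sparse_F_free i (Y : {set T}) : sparse Y -> ~ contains_F (Fam i k) e Y.
Proof.
move=> sp [S [f [sSY [fe [fsym FS]]]]].
have fdeg x : #|[set y in S | f x y]| <= deg S x.
  apply: subset_leq_card; apply/subsetP => y; rewrite !inE => /andP[-> /fe].
  by case/and3P.
have nstar : ~ star_fam k S f.
  move=> [c [cS [cardS fE]]].
  have := proj1 sp c (subsetP sSY c cS); rewrite ltnNge => /negP[].
  apply: leq_trans (deg_sub c sSY); apply: leq_trans (fdeg c).
  rewrite -ltnS -cardS (cardsD1 c) cS ltnS; apply: subset_leq_card.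
  by apply/subsetP => y; rewrite !inE fE => /andP[nyc ->]; rewrite eqxx nyc.
have nreg : ~ regular_fam k S f.
  move=> [S0 [d [kd fd]]]; have [x xS dx] := proj2 sp S sSY S0.
  by have := fdeg x; rewrite fd //; lia.
have nchr : ~ chromatic_fam k S f.
  apply; have [c [c1 c2]] := sparse_coloring (sparseS sSY sp).
  by exists c; split=> // x y /fe /and3P[xS yS]; apply: c2.
by case: i FS => [|[|[|i]]] //= [|[]].
Qed.

Lemma special_setT : special_set [set: T] -> special e k.
Proof.
case=> [[cT cl]|[k2 [a [b [c [d [f [p eT]]]]]]]].
  by left; split=> [|x y nxy]; [rewrite -cardsT|apply: cl; rewrite ?inE].
right; split=> //; pose s := [:: a; b; c; d; f].
exists (fun i : 'I_5 => nth a s i); split.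
  apply: inj_card_bij; last by rewrite card_ord -cardsT eT (card_pentagon p).
  case/and3P: p => u _ _ i j /eqP; rewrite nth_uniq // => /eqP; exact: val_inj.
case/and3P: p => _ /and5P[e1 e2 e3 e4 e5].
case/and5P=> /negbTE n1 /negbTE n2 /negbTE n3 /negbTE n4 /negbTE n5.
move=> [[|[|[|[|[|i]]]]] //= _] [[|[|[|[|[|j]]]]] //= _];
  rewrite ?eirr ?e1 ?e2 ?e3 ?e4 ?e5 ?n1 ?n2 ?n3 ?n4 ?n5 //;
  by rewrite esym ?e1 ?e2 ?e3 ?e4 ?e5 ?n1 ?n2 ?n3 ?n4 ?n5.
Qed.

End Isolation.

(** * The isolation number and its upper bound *)

Lemma iotaF_leq (F : Defs.family) (T : finType) (e : rel T) (D : {set T}) :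
  isolating F e D -> iotaF F e <= #|D|.
Proof.
move=> iD; rewrite /iotaF.
have : D \in index_enum {set T} by rewrite mem_index_enum.
elim: (index_enum _) => //= A s IHs; rewrite inE big_cons.
case/predU1P => [<-|/IHs le]; first by rewrite asboolT //= geq_minl.
by case: ifP => // _; apply: leq_trans (geq_minr _ _) le.
Qed.

(** The hypothesis on [#|T|] covers the default value of the minimum. *)
Lemma leq_iotaF (F : Defs.family) (T : finType) (e : rel T) m :
  m <= #|T| -> (forall D : {set T}, isolating F e D -> m <= #|D|) ->
  m <= iotaF F e.
Proof.
move=> mT mD; apply: (big_ind (fun n => m <= n)) => // [a b|D /asboolP/mD//].
by rewrite leq_min => -> ->.
Qed.

Lemma iotaF_upper (k i : nat) (T : finType) (e : rel T) : 0 < k ->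
  simple_graph e -> connected_graph e -> ~ special e k ->
  iotaF (Fam i k) e <= #|T| %/ k.+1.
Proof.
move=> k0 [esym eirr'] cT nsp.
have eirr x : e x x = false by apply/negbTE.
have [|D cD sD] := isolatable_no_special esym eirr k0 (X := [set: T]).
  move=> C [spC _ sep]; apply: nsp; apply: (special_setT esym eirr).
  suff <- : C = [set: T] by [].
  have [x xC] := set0Pn _ (special_neq0 k0 spC).
  apply/setP => y; rewrite inE; have /connectP[p ep ->] := cT x y.
  elim: p x xC ep => //= z p IHp x xC /andP[exz ep]; apply: IHp ep.
  by apply: contraT => zC; rewrite sep // !inE zC in exz.
apply: leq_trans (iotaF_leq (D := D) _) _; last by rewrite leq_divRL // -cardsT.
rewrite /isolating -setTD; exact: sparse_F_free sD.
Qed.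

(** * The graphs [B_{n,k}] *)

Lemma Bedge_simple n k : simple_graph (Bedge n k).
Proof.
split=> x; last by rewrite /Bedge eqxx.
move=> y; rewrite /Bedge eq_sym (eq_sym (x %/ k.+1) (y %/ k.+1)) andbCA.
by rewrite (orbC (_.+1 == y %/ k.+1)).
Qed.

(** Every vertex is equal or adjacent to the first vertex of its block, and the first vertices form
    a path, followed by induction on the block number. *)
Lemma Bedge_connected n k : connected_graph (Bedge n k).
Proof.
have csym : connect_sym (Bedge n k).
  by apply: sym_connect_sym => x y; have [] := Bedge_simple n k.
case: n csym => [|n] csym x y; first by case: x.
suff h m (z : 'I_n.+1) : z %/ k.+1 = m -> connect (Bedge n.+1 k) ord0 z.
  by apply: connect_trans (h _ y (erefl _)); rewrite csym; apply: h.
have hd (u : 'I_n.+1) : (u %/ k.+1) * k.+1 < n.+1.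
  by apply: leq_ltn_trans (leq_divM _ _) (ltn_ord u).
have toh (u w : 'I_n.+1) : w = (u %/ k.+1) * k.+1 :> nat -> connect (Bedge n.+1 k) w u.
  move=> ew; have [->|nwu] := eqVneq w u; first exact: connect0.
  by apply: connect1; rewrite /Bedge nwu ew mulnK ?eqxx.
elim: m z => [|m IHm] z zm.
  by apply: toh; rewrite zm mul0n.
apply: (connect_trans _ (toh z (Ordinal (hd z)) (erefl _))).
have lt : m * k.+1 < n.+1.
  by apply: leq_ltn_trans (hd z); rewrite zm leq_mul2r leqnSn orbT.
apply: connect_trans (IHm (Ordinal lt) _) _; first by rewrite /= mulnK.
apply: connect1; rewrite /Bedge -val_eqE /= zm !mulnK // !modnMl !eqxx /= orbT andbT.
by rewrite eqn_mul2r /=; lia.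
Qed.

Lemma Bedge_lower (k i n : nat) : 0 < k -> 0 < i <= 3 ->
  n %/ k.+1 <= iotaF (Fam i k) (Bedge n k).
Proof.
move=> k0 hi; apply: leq_iotaF => [|D iD]; first by rewrite card_ord leq_div.
rewrite -[leqLHS](size_iota 0) cardE -(size_map (fun v : 'I_n => v %/ k.+1)).
(* Counting by blocks: each full block [j] must contain a vertex of [D]. *)
apply: uniq_leq_size (iota_uniq _ _) _ => j; rewrite mem_iota add0n /= => jq.
apply: contraT => nj; case: iD.
have jD d : d \in D -> d %/ k.+1 != j.
  move=> dD; apply: contraNneq nj => <-.
  by apply: (map_f (fun v : 'I_n => v %/ k.+1)); rewrite mem_enum.
(* The offset [x.+1] skips the connecting vertex of block [j], so [h] lists the [k] vertices that
   have no neighbour outside the block. *)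
have jn (x : 'I_k) : j * k.+1 + x.+1 < n.
  have := leq_divM n k.+1; have := ltn_ord x.
  have : j.+1 * k.+1 <= n %/ k.+1 * k.+1 by rewrite leq_mul2r jq.
  by rewrite mulSn; lia.
pose h x := Ordinal (jn x).
have hq x : h x %/ k.+1 = j by rewrite /= divnMDl // divn_small ?addn0 // ltnS.
have hr x : h x %% k.+1 = x.+1 by rewrite /= modnMDl modn_small // ltnS.
have h_inj : injective h.
  by move=> x y /(congr1 (fun v : 'I_n => v %% k.+1)); rewrite !hr => -[/val_inj].
pose S := h @: setT.
have cS : #|S| = k by rewrite card_imset // cardsT card_ord.
pose f : rel 'I_n := fun x y => [&& x \in S, y \in S & x != y].
have sS : S \subset ~: cnbhd (Bedge n k) D.
  apply/subsetP => _ /imsetP[x _ ->]; rewrite in_setC; apply/cnbhdP => -[d dD].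
  case/orP=> [/eqP E|]; first by have := jD d dD; rewrite E hq eqxx.
  by rewrite /Bedge hq hr (negPf (jD d dD)) andbF /= andbF.
exists S, f; split=> //; split.
  move=> x y /and3P[xS yS nxy]; rewrite xS yS /= /Bedge nxy.
  by case/imsetP: xS => x' _ ->; case/imsetP: yS => y' _ ->; rewrite !hq eqxx.
split; first by move=> x y; rewrite /f eq_sym andbCA.
have reg : regular_fam k S f.
  split; first by rewrite -card_gt0 cS.
  exists (k - 1); split=> // x xS.
  rewrite -cS [in RHS](cardsD1 x) xS add1n subn1 /=; apply: eq_card => y.
  by rewrite !inE /f xS (eq_sym x); case: (y \in S); rewrite ?andbF ?andbT.
have chr : chromatic_fam k S f.
  move=> [c [c1 c2]].
  have : size [seq c (h x) | x <- enum 'I_k] <= size (iota 0 (k - 1)).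
    apply: uniq_leq_size.
      rewrite map_inj_uniq ?enum_uniq // => x y cxy; apply: h_inj; apply/eqP.
      apply: contraT => nxy; have := c2 (h x) (h y).
      by rewrite /f !imset_f // cxy eqxx => /(_ nxy).
    by move=> _ /mapP[x _ ->]; rewrite mem_iota add0n c1 // imset_f.
  by rewrite size_map size_iota -cardE card_ord; lia.
case: i hi => [|[|[|[|i]]]] //= _; by [left|right; left|].
Qed.

Theorem theorem5 (k i : nat) (hk : 1 <= k) (hi : i <= 3) :
  (forall (T : finType) (e : rel T),
     simple_graph e -> connected_graph e -> ~ special e k ->
     iotaF (Fam i k) e <= #|T| %/ k.+1) /\
  (forall n : nat, 1 <= i -> ~ special (Bedge n k) k ->
     iotaF (Fam i k) (Bedge n k) = n %/ k.+1).
Proof.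
split=> [T e|n i1 nsp]; first exact: iotaF_upper.
apply/eqP; rewrite eqn_leq Bedge_lower ?i1 // andbT -[n in _ <= n %/ _]card_ord.
apply: iotaF_upper => //; [exact: Bedge_simple|exact: Bedge_connected].
Qed.
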